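(* Let $A$ and $B$ be two nontrivial linear subspaces of $\mathbb R^d$ (each $\neq\{0\}$ and $\neq\mathbb R^d$). Let $x\in A\cup B$ be such that $\|P_AP_B(x)-P_{A\cap B}(x)\|>0$. Then $$\Lambda\left(x,\tfrac{P_A+P_B}{2}\right)\setminus\left\{0,\tfrac12,1\right\}=\left\{\tfrac12\pm\tfrac12\sqrt\lambda:\lambda\in\Lambda(x,P_BP_AP_B)\setminus\{0,1\}\right\}\neq\emptyset.$$
   Context: $\mathbb R^d$ is equipped with an arbitrary inner product $\langle\cdot,\cdot\rangle$ and the induced norm $\|\cdot\|$. For a subspace $M\subset\mathbb R^d$, $P_M$ denotes the orthogonal projection onto $M$. For a linear operator $T$ on $\mathbb R^d$, $\mathcal N(T)$ is its null space, $\lambda-T$ stands for $\lambda I-T$, $\Lambda(T):=\{\lambda\in\mathbb R:\mathcal N(\lambda-T)\neq\{0\}\}$ is the set of eigenvalues, and for $x\in\mathbb R^d$, $\Lambda(x,T):=\{\lambda\in\Lambda(T):P_{\mathcal N(\lambda-T)}(x)\neq0\}$. In the set on the right both signs are taken for every $\lambda$. *)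

(* Defs.v *)
From HB Require Import structures.
From mathcomp Require Import all_boot all_order all_algebra.
From mathcomp Require Import sesquilinear.
From mathcomp Require Import boolp classical_sets reals.

Set Implicit Arguments.
Unset Strict Implicit.
Unset Printing Implicit Defensive.

Import Order.TTheory GRing.Theory Num.Theory.
Local Open Scope classical_set_scope.
Local Open Scope ring_scope.

Section InnerProduct.
Variables (R : realType) (d : nat) (dot : {dot 'rV[R]_d for (@idfun R)}).
Implicit Types (x : 'rV[R]_d) (M : {vspace 'rV[R]_d}) (T : 'End('rV[R]_d)).

Definition dnorm x : R := Num.sqrt (dot x x).

(* The projection onto M along its dot-orthogonal complement; daddv_pi is only
   meaningful for complementary subspaces, cf. orthproj_mem, orthprojP below. *)
Definition orthproj M : 'End('rV[R]_d) := daddv_pi M (orthov dot M).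

Lemma orthproj_mem M x : orthproj M x \in M.
Proof. exact: memv_pi. Qed.

Let cap_orthov M : (M :&: orthov dot M = 0)%VS.
Proof.
apply/eqP; rewrite -subv0; apply/subvP => v; rewrite memv_cap => /andP[vM].
move=> /mem_orthovP/(_ _ vM) v0; rewrite memv0; apply/negPn/negP.
by move=> /(neq0_dnorm_gt0 (s := dot)); rewrite v0 ltxx.
Qed.

Lemma orthprojP M x : {in M, forall v, dot (x - orthproj M x) v = 0}.
Proof.
have sz N : (d - \dim N <= \dim (orthov dot N))%N.
  have dimF : \dim {:'rV[R]_d} = d by rewrite dimvf /dim /= mul1n.
  have aux n (s : seq 'rV[R]_d) : size s = n -> exists2 W : {vspace 'rV[R]_d},
      (d - n <= \dim W)%N & {in W & s, forall u v, dot u v = 0}.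
    elim: n s => [|n IHn] [|v s] //= => [_|[/IHn[W leW W0]]].
      by exists fullv; rewrite ?dimF ?subn0.
    exists (W :&: orthov dot <[v]>)%VS.
      by apply: leq_trans (leq_dim_orthov1 dot v W); rewrite subnS -!subn1 leq_sub2r.
    move=> u w; rewrite memv_cap mem_orthov1 inE => /andP[uW /eqP uv].
    by case/orP=> [/eqP->|/(W0 _ _ uW)].
  have [W leW W0] := aux _ (vbasis N) (size_tuple _).
  apply: leq_trans leW (dimvS _); apply/subvP => u uW; apply/mem_orthovP => w.
  move/coord_vbasis->; rewrite linear_sumr big1 //= => i _.
  by rewrite linearZr_LR /= W0 ?mulr0 ?mem_nth ?size_tuple.
have full : (M + orthov dot M)%VS = fullv.
  apply/eqP; rewrite eqEdim subvf dimv_disjoint_sum ?cap_orthov //.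
  by rewrite dimvf /dim /= mul1n -leq_subLR sz.
have E : orthproj M x + daddv_pi (orthov dot M) M x = x.
  by apply: daddv_pi_add; rewrite ?cap_orthov // full memvf.
move=> v vM; rewrite -{1}E addrC addKr.
by have /mem_orthovP/(_ _ vM) := memv_pi (orthov dot M) M x.
Qed.

Definition Lambda T : set R := [set l | passmx.leigenvalue T l].

Definition Lambda_at x T : set R :=
  [set l | Lambda T l /\ orthproj (passmx.leigenspace T l) x != 0].

End InnerProduct.

(* Main.v *)
Require Import Defs.
From mathcomp Require Import all_boot all_order all_algebra.
From mathcomp Require Import sesquilinear.
From mathcomp Require Import boolp classical_sets reals.
From mathcomp Require Import ring lra complex.

Set Implicit Arguments.
Unset Strict Implicit.
Unset Printing Implicit Defensive.

Import Order.TTheory GRing.Theory Num.Theory.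
Local Open Scope classical_set_scope.
Local Open Scope ring_scope.

(** Write S = P_B P_A P_B.  Membership of l in Lambda(x, T) means that T has an
    l-eigenvector that is not orthogonal to x ([Lambda_atP]), so the equality
    only asks to transport eigenvectors not orthogonal to x between
    (P_A + P_B)/2 and S.

    - Let P_A v + P_B v = (1 + m) v.  Applying P_A and P_B gives
      P_A P_B v = m P_A v and P_B P_A v = m P_B v, whence
      S (P_B v) = m^2 P_B v.  The eigenvalue (1 + m)/2 is none of 0, 1/2, 1
      exactly when m is none of -1, 0, 1, and then m^2 is neither 0 nor 1.
    - Let S w = s^2 w with s not in {-1, 0, 1}, where s is either square root of
      an eigenvalue of S, which is nonnegative.  Then w lies in B and
      v = P_A w + s w satisfies P_A v + P_B v = (1 + s) v.

    In both directions the inner product of x with the new vector is a nonzero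
    multiple of its inner product with the old one; this is where x being in A
    or in B enters ([eigen_sum_to_BAB], [eigen_BAB_to_sum]).

    For non-emptiness, suppose that x is orthogonal to every eigenvector of S
    whose eigenvalue is neither 0 nor 1.  As the fixed vectors of S are those of
    A cap B, and the projection onto A cap B kills all other eigenvectors,
    S x - P_(A cap B) x is orthogonal to every eigenvector of S.  By the
    spectral theorem for the self-adjoint S it vanishes, and this forces
    P_A P_B x = P_(A cap B) x ([BABproj_spectrum_nonempty]).

    The form of the spectral theorem that is needed, a vector orthogonal to all
    real eigenvectors is zero, is proved by descent on a polynomial p such that
    p(S) annihilates the vector, starting from the characteristic polynomial and
    removing one real-irreducible factor at a time
    ([orth_eigenvectors_eq0_mx]). *)

(** * Factors of real polynomials *)

Lemma size_quadratic (R : idomainType) (a c : R) :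
  size (('X - a%:P) ^+ 2 + c%:P) = 3%N.
Proof.
rewrite size_polyDl size_exp_XsubC // size_polyC.
exact: leq_ltn_trans (leq_b1 _) _.
Qed.

(** A complex root a + ib of p yields the factor: for b nonzero, the remainder of
    p by (X - a)^2 + b^2 is a real affine polynomial with a non-real root, so it
    is zero. *)
Lemma rcf_irreducible_factor (R : rcfType) (p : {poly R}) : (1 < size p)%N ->
  exists a b : R, root p a \/ b != 0 /\ (('X - a%:P) ^+ 2 + (b ^+ 2)%:P) %| p.
Proof.
move=> sp.
have [|[a b] rz] := @closed_rootP (complex R) (map_poly (real_complex R) p) _.
  by rewrite size_map_poly; case: ltngtP sp.
have [b0|b0] := eqVneq b 0.
  exists a, b; left; move: rz; rewrite b0.
  by rewrite -[Complex a 0]/(real_complex R a) fmorph_root.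
exists a, b; right; split=> //.
set q := _ + _.
have qz : (map_poly (real_complex R) q).[Complex a b] = 0.
  rewrite /q rmorphD rmorphXn rmorphB /= map_polyX !map_polyC /= !hornerE /=.
  by apply/eqP; rewrite eq_complex /=; apply/andP; split; apply/eqP; ring.
have sq : size q = 3%N by exact: size_quadratic.
have q0 : q != 0 by rewrite -size_poly_eq0 sq.
set r := p %% q.
have sr : (size r <= 2)%N by rewrite -ltnS -sq ltn_modp.
have rE : r = r`_1 *: 'X + (r`_0)%:P.
  apply/polyP => -[|[|i]]; rewrite coefD coefZ coefX coefC /=;
    rewrite ?mulr0 ?mulr1 ?addr0 ?add0r //.
  by rewrite nth_default // (leq_trans sr).
have : (map_poly (real_complex R) r).[Complex a b] = 0.
  move: rz; rewrite {1}(divp_eq p q) rmorphD rmorphM /= /root !hornerE qz.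
  by rewrite mulr0 add0r => /eqP.
rewrite rE rmorphD /= map_polyZ map_polyX map_polyC /= !hornerE /= => -[].
rewrite !mul0r !addr0 subr0 => r0 /eqP.
rewrite mulf_eq0 (negPf b0) orbF => /eqP r1.
rewrite r1 mul0r add0r in r0.
by rewrite /dvdp -/r rE r0 r1 scale0r addr0.
Qed.

(** * Orthogonal projections and eigenvectors *)

Section InnerProduct.
Variables (R : realType) (d : nat) (dot : {dot 'rV[R]_d for (@idfun R)}).
Implicit Types (u v w x y z : 'rV[R]_d) (M N : {vspace 'rV[R]_d}).
Implicit Types T : 'End('rV[R]_d).

Lemma dotC u v : dot u v = dot v u.
Proof. by rewrite (hermC dot) expr0 mul1r. Qed.

Lemma dot_eq0 u : dot u u = 0 -> u = 0.
Proof.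
move=> u0; apply/eqP/negPn/negP => /(neq0_dnorm_gt0 (s := dot)).
by rewrite u0 ltxx.
Qed.

Lemma dot_ge0 u : 0 <= dot u u.
Proof.
have [->|/(neq0_dnorm_gt0 (s := dot))/ltW //] := eqVneq u 0.
by rewrite linear0l.
Qed.

Lemma orthproj_dotl M u v : v \in M -> dot (orthproj dot M u) v = dot u v.
Proof.
by move=> vM; apply/esym/eqP; rewrite -subr_eq0 -linearBl /= orthprojP.
Qed.

Lemma orthproj_selfadj M u v :
  dot (orthproj dot M u) v = dot u (orthproj dot M v).
Proof.
rewrite -(orthproj_dotl u (orthproj_mem dot M v)).
by rewrite dotC [RHS]dotC [RHS]orthproj_dotl ?orthproj_mem.
Qed.

Lemma orthproj_id M u : u \in M -> orthproj dot M u = u.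
Proof.
move=> uM; apply/esym/eqP; rewrite -subr_eq0; apply/eqP/dot_eq0.
by apply: orthprojP; rewrite rpredB ?orthproj_mem.
Qed.

Lemma orthproj_idem M u : orthproj dot M (orthproj dot M u) = orthproj dot M u.
Proof. by rewrite orthproj_id ?orthproj_mem. Qed.

Lemma orthproj_eq0P M u :
  (orthproj dot M u == 0) <-> {in M, forall v, dot u v = 0}.
Proof.
split=> [/eqP Pu0 v vM|u0]; first by rewrite -(orthproj_dotl u vM) Pu0 linear0l.
by apply/eqP/dot_eq0; rewrite orthproj_dotl ?u0 ?orthproj_mem.
Qed.

Lemma mem_leigenspace T l v :
  (v \in passmx.leigenspace T l) = (T v == l *: v).
Proof. by rewrite memv_ker add_lfunE opp_lfunE scale_lfunE id_lfunE subr_eq0. Qed.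

(** Since the projection P onto the eigenspace is self-adjoint and idempotent,
    <x, P x> = |P x|^2, so P x itself is the witness when it is nonzero. *)
Lemma Lambda_atP x T l :
  Lambda_at dot x T l <-> exists2 v, T v = l *: v & dot x v != 0.
Proof.
rewrite /Lambda_at /Lambda /=; split=> [[_ Px]|[v Tv xv]].
  exists (orthproj dot (passmx.leigenspace T l) x).
    by apply/eqP; rewrite -mem_leigenspace orthproj_mem.
  apply: contra_neq Px => xPx; apply: dot_eq0.
  by rewrite orthproj_selfadj orthproj_id ?orthproj_mem.
have vE : v \in passmx.leigenspace T l by rewrite mem_leigenspace Tv.
split; last first.
  by apply/negP => /orthproj_eq0P/(_ v vE)/eqP; apply/negP.
apply: contra_neqN xv => /eqP E0.
by move: vE; rewrite E0 memv0 => /eqP ->; rewrite linear0r.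
Qed.

End InnerProduct.

(** * Spectral theorem for self-adjoint operators *)

Section Spectral.
Variables (R : realType) (n : nat) (dot : {dot 'rV[R]_n.+1 for (@idfun R)}).
Variable M : 'M[R]_n.+1.
Hypothesis M_selfadj : forall u v, dot (u *m M) v = dot u (v *m M).

Lemma horner_mx_selfadj p u v :
  dot (u *m horner_mx M p) v = dot u (v *m horner_mx M p).
Proof.
elim/poly_ind: p u v => [|p c IH] u v.
  by rewrite rmorph0 !mulmx0 linear0l linear0r.
rewrite rmorphD rmorphM /= horner_mx_X horner_mx_C !mulmxDr !mul_mx_scalar.
rewrite linearDl linearDr /= linearZl_LR linearZr_LR /=; congr (_ + _).
by rewrite !mulmxA M_selfadj IH -!mulmxA (comm_mx_horner p (comm_mx_refl M)).
Qed.

Lemma horner_mx_eigen p (z : 'rV_n.+1) a :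
  z *m M = a *: z -> z *m horner_mx M p = p.[a] *: z.
Proof.
move=> Mz; elim/poly_ind: p => [|p c IH].
  by rewrite rmorph0 mulmx0 horner0 scale0r.
rewrite rmorphD rmorphM /= horner_mx_X horner_mx_C mulmxDr mul_mx_scalar.
by rewrite mulmxA IH -scalemxAl Mz !hornerE scalerA scalerDl.
Qed.

(** If p(M) y = 0 and p = q f with f irreducible, then z = q(M) y is killed by
    f(M).  When f = X - a, z is an eigenvector and
    <z, z> = <y, q(M) z> = q(a) <y, z> = 0.  When f = (X - a)^2 + b^2, pairing
    f(M) z = 0 with z gives |(M - a) z|^2 + b^2 |z|^2 = 0.  In both cases z = 0,
    so q replaces p. *)
Lemma orth_eigenvectors_eq0_mx y :
  (forall a z, z *m M = a *: z -> dot y z = 0) -> y = 0.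
Proof.
move=> yorth.
suff H m : forall p : {poly R}, (size p <= m)%N -> p != 0 ->
    y *m horner_mx M p = 0 -> y = 0.
  apply: (H _ (char_poly M) (leqnn _)).
    by rewrite monic_neq0 ?char_poly_monic.
  by rewrite Cayley_Hamilton mulmx0.
elim: m => [|m IH] p sp p0 yp; first by move: p0; rewrite -size_poly_leq0 sp.
have [sp1|sp1] := leqP (size p) 1%N.
  move: yp p0; rewrite (size1_polyC sp1) horner_mx_C mul_mx_scalar polyC_eq0.
  by move/eqP; rewrite scaler_eq0 => /orP[->//|/eqP].
have [a [b]] := rcf_irreducible_factor sp1.
case=> [/factor_theorem[q pE]|[b0 /dvdpP[q pE]]];
    have q0 : q != 0 by apply: contraNneq p0 => q0; rewrite pE q0 mul0r.
  apply: (IH q) => //.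
    by move: sp; rewrite pE size_Mmonic ?monicXsubC // size_XsubC addn2.
  move: yp; rewrite pE rmorphM rmorphB /= horner_mx_X horner_mx_C mulmxA.
  set z := y *m horner_mx M q => /eqP.
  rewrite mulmxBr mul_mx_scalar subr_eq0 => /eqP Mz.
  apply: (@dot_eq0 _ _ dot); rewrite {1}/z horner_mx_selfadj.
  by rewrite (horner_mx_eigen q Mz) linearZr_LR /= (yorth _ _ Mz) mulr0.
apply: (IH q) => //.
  have sQ := size_quadratic a (b ^+ 2).
  move: sp; rewrite pE size_mul // -?size_poly_eq0 sQ // addn3.
  by move/ltnW.
move: yp; rewrite pE rmorphM rmorphD rmorphXn rmorphB /=.
rewrite horner_mx_X !horner_mx_C mulmxA.
set z := y *m horner_mx M q; rewrite mulmxDr mul_mx_scalar expr2 mulmxA.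
set N := M - _ => zN.
have Nsa u v : dot (u *m N) v = dot u (v *m N).
  by rewrite !mulmxBr !mul_mx_scalar linearBl linearBr /= M_selfadj
    linearZl_LR linearZr_LR.
have := congr1 (dot z) zN.
rewrite linear0r linearDr /= linearZr_LR /= -Nsa => s0.
apply: (@dot_eq0 _ _ dot); apply: le_anti; rewrite dot_ge0 andbT.
have b2 : 0 < b ^+ 2 by rewrite lt_neqAle sqr_ge0 andbT eq_sym sqrf_eq0.
rewrite -(pmulr_rle0 _ b2) -s0 -subr_ge0 addrK.
exact: dot_ge0.
Qed.
End Spectral.

Lemma orth_eigenvectors_eq0 (R : realType) (d : nat)
    (dot : {dot 'rV[R]_d for (@idfun R)}) (T : 'End('rV[R]_d)) (y : 'rV[R]_d) :
    (forall u v, dot (T u) v = dot u (T v)) ->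
  (forall a z, T z = a *: z -> dot y z = 0) -> y = 0.
Proof.
case: d dot T y => [|n] dot' T y Tsa yorth; first by rewrite [y]thinmx0.
have TM (u : 'rV_n.+1) : u *m lin1_mx T = T u by rewrite mul_rV_lin1.
apply: (@orth_eigenvectors_eq0_mx _ _ dot' (lin1_mx T)) => [u v|a z].
  by rewrite !TM.
by rewrite TM; exact: yorth.
Qed.

(** * The operators P_A + P_B and P_B P_A P_B *)

Section TwoSubspaces.
Variables (R : realType) (d : nat) (dot : {dot 'rV[R]_d for (@idfun R)}).
Implicit Types (u v w x y z : 'rV[R]_d).

Variables A B : {vspace 'rV[R]_d}.
Local Notation PA := (orthproj dot A).
Local Notation PB := (orthproj dot B).
Local Notation T := (2^-1 *: (PA + PB)).
Local Notation S := (PB \o PA \o PB)%VF.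

Lemma sumprojE (m : R) v : T v = (2^-1 + 2^-1 * m) *: v <->
  PA v + PB v = (1 + m) *: v.
Proof.
rewrite scale_lfunE add_lfunE -[X in X + _ * m]mulr1 -mulrDr -scalerA.
have h : (2^-1 : R) != 0 by rewrite invr_eq0 pnatr_eq0.
by split=> [/(scalerI h)|->].
Qed.

Lemma BABprojE v : S v = PB (PA (PB v)).
Proof. by rewrite !comp_lfunE. Qed.

Lemma BABproj_selfadj u v : dot (S u) v = dot u (S v).
Proof. by rewrite !BABprojE !orthproj_selfadj. Qed.

(** The nonvanishing is where x in A or B is used: <x, P_B v> is <x, v> if x lies
    in B, and <x, P_A P_B v> = m <x, v> if x lies in A. *)
Lemma eigen_sum_to_BAB (m : R) x v :
    x \in A \/ x \in B -> m != 0 -> PA v + PB v = (1 + m) *: v -> dot x v != 0 ->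
  S (PB v) = m ^+ 2 *: PB v /\ dot x (PB v) != 0.
Proof.
move=> xAB m0 Tv xv.
have ABv : PA (PB v) = m *: PA v.
  have := congr1 PA Tv; rewrite linearD linearZ /= (orthproj_idem dot A).
  by rewrite scalerDl scale1r => /addrI.
have BAv : PB (PA v) = m *: PB v.
  have := congr1 PB Tv; rewrite linearD linearZ /= (orthproj_idem dot B).
  by rewrite scalerDl scale1r addrC => /addrI.
split.
  by rewrite BABprojE (orthproj_idem dot B) ABv linearZ /= BAv scalerA.
rewrite -orthproj_selfadj; case: xAB => xM; last by rewrite orthproj_id.
rewrite orthproj_selfadj -{1}(orthproj_id dot xM) orthproj_selfadj ABv.
rewrite linearZr_LR /=.
by rewrite -orthproj_selfadj orthproj_id // mulf_neq0.
Qed.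

(** As w lies in B, P_A + P_B maps w to P_A w + w and P_A w to P_A w + s^2 w;
    solving for the eigenvalue 1 + s in their span gives v = P_A w + s w.  The inner
    product <x, v> is (1 + s) <x, w> if x lies in A, and s (s + 1) <x, w> if x
    lies in B. *)
Lemma eigen_BAB_to_sum (s : R) x w :
    x \in A \/ x \in B -> s != 0 -> s + 1 != 0 ->
    S w = s ^+ 2 *: w -> dot x w != 0 ->
  exists2 v, PA v + PB v = (1 + s) *: v & dot x v != 0.
Proof.
move=> xAB s0 s1 Sw xw.
have wB : PB w = w.
  apply: orthproj_id; rewrite -[w]scale1r -(mulVf (expf_neq0 2 s0)) -scalerA -Sw.
  by rewrite rpredZ // BABprojE orthproj_mem.
have BAw : PB (PA w) = s ^+ 2 *: w by rewrite -Sw BABprojE wB.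
exists (PA w + s *: w).
  rewrite (linearD PA) (linearD PB) (linearZ_LR PA) (linearZ_LR PB) /=.
  rewrite BAw wB (orthproj_idem dot A).
  by rewrite scalerDl scale1r scalerDr scalerA -expr2
    [s ^+ 2 *: w + _]addrC addrACA.
rewrite linearDr /= linearZr_LR /=; case: xAB => xM.
  rewrite -orthproj_selfadj orthproj_id // -{1}[dot x w]mul1r -mulrDl.
  by rewrite mulf_neq0 // addrC.
rewrite -{1}(orthproj_id dot xM) orthproj_selfadj BAw linearZr_LR /= -mulrDl.
by rewrite mulf_neq0 // expr2 -{3}[s]mulr1 -mulrDr mulf_neq0.
Qed.

Lemma BABproj_eigen_ge0 (l : R) w : S w = l *: w -> w != 0 -> 0 <= l.
Proof.
move=> Sw w0.
have: 0 <= dot (S w) w.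
  rewrite BABprojE orthproj_selfadj -(orthproj_idem dot A (PB w)).
  by rewrite orthproj_selfadj; exact: dot_ge0.
have ww : 0 < dot w w by rewrite (neq0_dnorm_gt0 (s := dot)).
by rewrite Sw linearZl_LR /= pmulr_lge0.
Qed.

(** A fixed z lies in B, so <z, z> = <P_A z, z>, which leaves no room for the
    component of z orthogonal to A. *)
Lemma BABproj_fixed z : S z = z -> z \in (A :&: B)%VS.
Proof.
move=> Sz.
have zB : z \in B by rewrite -Sz BABprojE orthproj_mem.
rewrite memv_cap zB andbT.
suff -> : z = PA z by exact: orthproj_mem.
apply/eqP; rewrite -subr_eq0; apply/eqP/(@dot_eq0 _ _ dot).
rewrite linearBr /= [X in _ - X]orthprojP ?orthproj_mem // subr0 linearBl /=.
apply/eqP; rewrite subr_eq0 -{1}Sz BABprojE orthproj_selfadj.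
by rewrite !(orthproj_id dot zB).
Qed.

(** S fixes every w in A cap B, so a <z, w> = <S z, w> = <z, S w> = <z, w>. *)
Lemma orthproj_cap_eigen a z : S z = a *: z -> a != 1 ->
  orthproj dot (A :&: B) z = 0.
Proof.
move=> Sz a1; apply/eqP/orthproj_eq0P => w; rewrite memv_cap => /andP[wA wB].
have : dot (S z) w = dot z w.
  by rewrite BABproj_selfadj BABprojE (orthproj_id dot wB)
    (orthproj_id dot wA) orthproj_id.
rewrite Sz linearZl_LR /= -{2}[dot z w]mul1r => /eqP.
by rewrite -subr_eq0 -mulrBl mulf_eq0 subr_eq0 (negPf a1) => /eqP.
Qed.

(** Otherwise S x - P x, with P the projection onto A cap B, is orthogonal to all
    eigenvectors of S, hence zero.  To conclude, h = P_A P_B x - P x satisfies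
    <h, h> = <P_B x - P x, P_B h> because h is in A and P_B x - P x is in B, and
    P_B h = S x - P x. *)
Lemma BABproj_spectrum_nonempty x :
    PA (PB x) != orthproj dot (A :&: B) x ->
  exists2 l, l != 0 /\ l != 1 & Lambda_at dot x S l.
Proof.
move=> hx; apply: contrapT => noeig.
have orth l z : l != 0 -> l != 1 -> S z = l *: z -> dot x z = 0.
  move=> l0 l1 Sz; apply: contrapT => /eqP xz; apply: noeig.
  by exists l => //; apply/Lambda_atP; exists z.
set P := orthproj dot (A :&: B) in hx.
have /andP[Px_A Px_B] : (P x \in A) && (P x \in B).
  by rewrite -memv_cap orthproj_mem.
have SxP : S x - P x = 0.
  apply: (@orth_eigenvectors_eq0 _ _ dot S) => [u v|a z Sz]; first exact: BABproj_selfadj.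
  rewrite linearBl /= BABproj_selfadj Sz linearZr_LR /= orthproj_selfadj.
  have [a1|a1] := eqVneq a 1.
    rewrite a1 mul1r orthproj_id ?subrr //.
    by apply: BABproj_fixed; rewrite Sz a1 scale1r.
  rewrite (orthproj_cap_eigen Sz a1) linear0r subr0.
  by have [->|a0] := eqVneq a 0; rewrite ?mul0r // (orth _ _ a0 a1 Sz) mulr0.
move/eqP: hx; apply; apply/eqP; rewrite -subr_eq0; apply/eqP.
have hA : PA (PB x) - P x \in A by rewrite rpredB ?orthproj_mem.
apply: (@dot_eq0 _ _ dot).
rewrite -{1}(orthproj_id dot Px_A) -linearB /= orthproj_selfadj (orthproj_id dot hA).
have PBxB : PB x - P x \in B by rewrite rpredB ?orthproj_mem.
rewrite -{1}(orthproj_id dot PBxB) orthproj_selfadj linearB /= (orthproj_id dot Px_B).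
by rewrite -BABprojE SxP linear0r.
Qed.

End TwoSubspaces.

(** * The two spectra at x *)

Theorem theorem3p17 (R : realType) (d : nat)
    (dot : {dot 'rV[R]_d for (@idfun R)})
    (A B : {vspace 'rV[R]_d})
    (A_neq0 : A != 0%VS) (A_neqT : A != fullv)
    (B_neq0 : B != 0%VS) (B_neqT : B != fullv)
    (x : 'rV[R]_d) (xAB : x \in A \/ x \in B)
    (hx : 0 < dnorm dot (orthproj dot A (orthproj dot B x)
                         - orthproj dot (A :&: B)%VS x)) :
  let PA := orthproj dot A in
  let PB := orthproj dot B in
  let L := Lambda_at dot x (2^-1 *: (PA + PB)) `\` [set 0; 2^-1; 1] in
  let S := \bigcup_(l in Lambda_at dot x (PB \o PA \o PB)%VF `\` [set 0; 1])
             [set 2^-1 + 2^-1 * Num.sqrt l; 2^-1 - 2^-1 * Num.sqrt l] in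
  L = S /\ S !=set0.
Proof.
move=> PA PB L S; split; last first.
  have [|l [l0 l1] lS] := @BABproj_spectrum_nonempty R d dot A B x.
    rewrite -subr_eq0; apply/eqP => h0; move: hx.
    by rewrite h0 /dnorm linear0l sqrtr0 ltxx.
  exists (2^-1 + 2^-1 * Num.sqrt l), l; last by left.
  by split=> // -[/eqP|/eqP]; apply/negP.
apply/seteqP; split=> [mu|mu].
  rewrite /L /= => -[/Lambda_atP[v Tv xv] muE].
  have [s muD] : exists s, mu = 2^-1 + 2^-1 * s.
    by exists (2 * mu - 1); field.
  have s0 : s != 0.
    by apply: contra_not_neq muE => s0; left; right; rewrite muD s0; field.
  have s1 : s != 1.
    by apply: contra_not_neq muE => s1; right; rewrite muD s1; field.
  have sN1 : s != -1.
    by apply: contra_not_neq muE => s1'; left; left; rewrite muD s1'; field.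
  move: Tv; rewrite muD => /sumprojE Tv.
  have [Sw xw] := eigen_sum_to_BAB xAB s0 Tv xv.
  exists (s ^+ 2).
    split; first by apply/Lambda_atP; exists (PB v).
    rewrite /= => -[/eqP|/eqP]; apply/negP; first by rewrite expf_neq0.
    by rewrite sqrf_eq1 negb_or s1.
  rewrite /= sqrtr_sqr; have [s_ge|s_lt] := leP 0 s; first by left; rewrite ger0_norm.
  by right; rewrite ltr0_norm // mulrN opprK.
move=> [l [/Lambda_atP[w Sw xw] lE] muE].
have w0 : w != 0 by apply: contra_neq xw => ->; rewrite linear0r.
have l_ge0 := BABproj_eigen_ge0 Sw w0.
have l0 : l != 0 by apply: contra_not_neq lE => ->; left.
have l1 : l != 1 by apply: contra_not_neq lE => ->; right.
have [s sl muD] : exists2 s, s ^+ 2 = l & mu = 2^-1 + 2^-1 * s.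
  case: muE => ->; first by exists (Num.sqrt l); rewrite ?sqr_sqrtr.
  by exists (- Num.sqrt l); rewrite ?sqrrN ?sqr_sqrtr // mulrN.
rewrite -sl in Sw l0 l1; rewrite sqrf_eq0 in l0.
move: l1; rewrite sqrf_eq1 negb_or => /andP[s1 sN1].
have sD1 : s + 1 != 0 by rewrite addr_eq0.
have [v Tv xv] := eigen_BAB_to_sum xAB l0 sD1 Sw xw.
split; first by apply/Lambda_atP; exists v => //; rewrite muD; apply/sumprojE.
rewrite muD; case=> [[]|] /= e.
- by move/eqP: sN1; apply; lra.
- by move/eqP: l0; apply; lra.
- by move/eqP: s1; apply; lra.
Qed.
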